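(* Let $\mathcal{A}_0=(A,\Rightarrow,0)$ be an algebra of type $(2,0)$, put $1:=0\Rightarrow 0$, and suppose that for all $x,y,z\in A$: (i) $x\Rightarrow x=1$, $x\Rightarrow 1=1$, $1\Rightarrow x=x$; (ii) $y\Rightarrow(x\Rightarrow y)=1$; (iii) $(x\Rightarrow y)\Rightarrow y=(y\Rightarrow x)\Rightarrow x$; (iv) $(((x\Rightarrow y)\Rightarrow y)\Rightarrow z)\Rightarrow(x\Rightarrow z)=1$; (I5) $0\Rightarrow x=1$. Define $\rceil x:=x\Rightarrow 0$ and $x\oplus y:=\rceil x\Rightarrow y$ for all $x,y\in A$. Then $\mathcal{B}(\mathcal{A}_0)=(A,\oplus,\rceil,0)$ is a basic algebra, and its implication $\rceil x\oplus y$ coincides with $x\Rightarrow y$ for all $x,y\in A$.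
   Context: A basic algebra is an algebra $(A,\oplus,\rceil,0)$ of type $(2,1,0)$ satisfying, for all $x,y,z$: (BA1) $x\oplus 0=x$; (BA2) $\rceil\rceil x=x$; (BA3) $\rceil(\rceil x\oplus y)\oplus y=\rceil(\rceil y\oplus x)\oplus x$; (BA4) $\rceil(\rceil(\rceil(x\oplus y)\oplus y)\oplus z)\oplus(x\oplus z)=1$, where $1:=\rceil 0$. The implication of a basic algebra is the term $\rceil x\oplus y$. *)

(* Defs.v *)
Record is_basic_algebra (A : Type) (oplus : A -> A -> A) (neg : A -> A)
    (zero : A) : Prop := IsBasicAlgebra {
  BA1 : forall x, oplus x zero = x;
  BA2 : forall x, neg (neg x) = x;
  BA3 : forall x y,
    oplus (neg (oplus (neg x) y)) y = oplus (neg (oplus (neg y) x)) x;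
  BA4 : forall x y z,
    oplus (neg (oplus (neg (oplus (neg (oplus x y)) y)) z)) (oplus x z)
    = neg zero
}.

Arguments is_basic_algebra {A} oplus neg zero.

Definition basic_imp {A : Type} (oplus : A -> A -> A) (neg : A -> A)
  (x y : A) : A := oplus (neg x) y.

Section Derived.

Context {A : Type} (imp : A -> A -> A) (zero : A).

Definition imp_one : A := imp zero zero.
Definition imp_neg (x : A) : A := imp x zero.
Definition imp_oplus (x y : A) : A := imp (imp_neg x) y.

End Derived.

(* Main.v *)
Require Import Defs.

Theorem theorem6 (A : Type) (imp : A -> A -> A) (zero : A)
  (i_refl : forall x, imp x x = imp_one imp zero)
  (i_top : forall x, imp x (imp_one imp zero) = imp_one imp zero)
  (i_unit : forall x, imp (imp_one imp zero) x = x)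
  (ii : forall x y, imp y (imp x y) = imp_one imp zero)
  (iii : forall x y, imp (imp x y) y = imp (imp y x) x)
  (iv : forall x y z,
      imp (imp (imp (imp x y) y) z) (imp x z) = imp_one imp zero)
  (I5 : forall x, imp zero x = imp_one imp zero) :
  is_basic_algebra (imp_oplus imp zero) (imp_neg imp zero) zero /\
  (forall x y,
      basic_imp (imp_oplus imp zero) (imp_neg imp zero) x y = imp x y).
Proof.
assert (negK : forall x, imp (imp x zero) zero = x).
(* Commuting the join by [iii] gives [(0 => x) => x], which is [1 => x = x]. *)
{ intros x. now rewrite iii, I5, i_unit. }
unfold basic_imp, imp_oplus, imp_neg.
(* Once double negations cancel, BA1 and BA2 are [negK] itself, BA3 is [iii], and BA4 is [iv] with
   [imp x zero] for [x], as [neg zero] unfolds to [imp_one]. The two implications then agree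
   syntactically. *)
split; [split|]; intros; rewrite ?negK; auto.
Qed.
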